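(* Let $m$ and $F$ be positive integers with $F\geq 3$, $m\leq\frac{F+2}{2}$ and $m\nmid F$. Define sets of numerical semigroups recursively by $A_0=\{C(m,F)\}$ and $A_{i+1}=\bigcup_{S\in A_i}E(S)$ for $i\ge 0$, where $E(S)=\{(S\setminus\{x\})\cup\{F-x\}\mid x\in\alpha(S)\}$. Then the procedure that computes $A_0,A_1,A_2,\ldots$ until the first empty $A_i$, and returns the union of the sets computed, is correct: it terminates (i.e. $A_i=\varnothing$ for some $i$) and its output is $\bigcup_{i\geq 0}A_i=\mathscr I(m,F)$.
   Context: $\mathbb N$ denotes the non-negative integers. A numerical semigroup is a submonoid $S$ of $(\mathbb N,+)$ with $\mathbb N\setminus S$ finite. Its multiplicity $\operatorname{m}(S)$ is the smallest positive integer in $S$; its Frobenius number is the largest integer not in $S$. A numerical semigroup is irreducible if it cannot be expressed as the intersection of two numerical semigroups properly containing it. $\mathscr I(m,F)$ is the set of all irreducible numerical semigroups with multiplicity $m$ and Frobenius number $F$. $\operatorname{msg}(S)$ is the (unique) minimal system of generators of the monoid $S$. The ratio $\operatorname{r}(S)$ is the smallest element of $S$ that is not a multiple of $\operatorname{m}(S)$. $C(m,F)$ denotes the unique element of $\mathscr I(m,F)$ with ratio greater than $F/2$ (it exists and is unique under the stated hypotheses on $m,F$). For $S\in\mathscr I(m,F)$, $$\alpha(S):=\Big\{x\in\operatorname{msg}(S)\;\Big|\;\tfrac F2<x<F,\ 2x-F\notin S,\ 3x\neq 2F,\ 4x\neq 3F,\ \operatorname{m}(S)<F-x<\operatorname{r}(S)\Big\}.$$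 *)

(* Defs.v *)
From mathcomp Require Import all_boot all_order.
From mathcomp Require Import boolp classical_sets functions cardinality.

Set Implicit Arguments.
Unset Strict Implicit.
Unset Printing Implicit Defensive.

Local Open Scope classical_set_scope.

Definition is_smallest (A : set nat) (n : nat) : Prop :=
  A n /\ forall k, A k -> (n <= k)%N.

Definition is_largest (A : set nat) (n : nat) : Prop :=
  A n /\ forall k, A k -> (k <= n)%N.

(* The default value 0 is only reached when A is empty. *)
Definition minimum (A : set nat) : nat := xget 0%N (is_smallest A).

Definition submonoid (S : set nat) : Prop :=
  S 0%N /\ forall x y, S x -> S y -> S (x + y)%N.

Definition numerical_semigroup (S : set nat) : Prop :=
  submonoid S /\ finite_set (~` S).

Definition multiplicity (S : set nat) : nat :=
  minimum [set x | S x /\ (0 < x)%N].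

(* Natural-valued, so setT, whose Frobenius number is -1 by convention,
   satisfies this for no F. *)
Definition has_frobenius (S : set nat) (F : nat) : Prop :=
  is_largest (~` S) F.

Definition irreducible (S : set nat) : Prop :=
  numerical_semigroup S /\
  ~ exists S1 S2 : set nat,
      [/\ numerical_semigroup S1, numerical_semigroup S2,
          S `<` S1, S `<` S2 & S = S1 `&` S2].

Definition irreducibles (m F : nat) : set (set nat) :=
  [set S | [/\ irreducible S, multiplicity S = m & has_frobenius S F]].

Definition generated (X : set nat) : set nat := smallest submonoid X.

Definition minimal_system_of_generators (S X : set nat) : Prop :=
  generated X = S /\ forall Y : set nat, Y `<` X -> generated Y <> S.

Definition msg (S : set nat) : set nat :=
  xget set0 (minimal_system_of_generators S).

(* For S = setT every element is a multiple of the multiplicity, and the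
   value is the default 0. *)
Definition ratio (S : set nat) : nat :=
  minimum [set x | S x /\ ~~ (multiplicity S %| x)%N].

(* The default value set0 is not a numerical semigroup: it marks the case where
   no semigroup has the required property. *)
Definition Csg (m F : nat) : set nat :=
  xget set0 [set S | irreducibles m F S /\ (F < 2 * ratio S)%N].

(* F is the Frobenius number of S. The truncated subtractions are exact, since
   F < 2 * x and x < F. *)
Definition alpha (F : nat) (S : set nat) : set nat :=
  [set x | [/\ msg S x,
               (F < 2 * x)%N /\ (x < F)%N,
               ~ S (2 * x - F)%N,
               (3 * x)%N <> (2 * F)%N /\ (4 * x)%N <> (3 * F)%N
             & (multiplicity S < F - x)%N /\ (F - x < ratio S)%N]].

Definition E (F : nat) (S : set nat) : set (set nat) :=
  [set (S `\ x) `|` [set (F - x)%N] | x in alpha F S].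

Fixpoint A (m F i : nat) : set (set nat) :=
  if i is j.+1 then \bigcup_(S in A m F j) E F S else [set Csg m F].

(* The procedure computes A_0, A_1, ..., stops at the first empty A_n and
   returns out, the union of the sets computed. *)
Definition procedure_returns (m F : nat) (out : set (set nat)) : Prop :=
  exists n : nat,
    [/\ A m F n = set0,
        forall i, (i < n)%N -> A m F i <> set0
      & out = \bigcup_(i in [set i | (i <= n)%N]) A m F i].

(* Main.v *)
Require Import Defs.
From mathcomp Require Import all_boot all_order.
From mathcomp Require Import boolp classical_sets functions cardinality.
From mathcomp Require Import zify.

(** The inverse of the step [S |-> (S \ x) U {F - x}] is
    [T |-> (T \ r(T)) U {F - r(T)}], which is defined on every irreducible
    semigroup of ratio at most [F / 2] and strictly increases the ratio; iterating
    it must end in the only semigroup of ratio greater than [F / 2], namely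
    [C(m, F)].  Conversely each forward step strictly decreases the ratio, so the
    process stops.  Irreducibility is handled through the duality
    [x \notin S, x <> F / 2 -> F - x \in S]. *)

Local Open Scope classical_set_scope.

(** * Least elements of sets of naturals *)

Lemma is_smallest_uniq {A : set nat} {a b : nat} :
  is_smallest A a -> is_smallest A b -> a = b.
Proof.
by move=> [Aa ha] [Ab hb]; apply/eqP; rewrite eqn_leq ha ?hb.
Qed.

Lemma is_smallest_minimum {A : set nat} (n : nat) :
  A n -> is_smallest A (minimum A).
Proof.
move=> An; apply: xgetPex.
have exA : exists k, `[< A k >] by exists n; apply/asboolP.
case: (ex_minnP exA) => k /asboolP Ak kmin.
by exists k; split=> // j Aj; apply: kmin; apply/asboolP.
Qed.

Lemma minimum_eq (A : set nat) (n : nat) : is_smallest A n -> minimum A = n.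
Proof.
by move=> An; have [An0 _] := An; apply: is_smallest_uniq (is_smallest_minimum n An0) An.
Qed.

(** * Atoms and the minimal system of generators *)

Definition atoms (S : set nat) : set nat :=
  [set x | [/\ S x, (0 < x)%N & forall a b, S a -> S b ->
                 (0 < a)%N -> (0 < b)%N -> x <> (a + b)%N]].

Lemma submonoid_setD1 {S : set nat} {x : nat} :
  submonoid S -> atoms S x -> submonoid (S `\ x).
Proof.
move=> [S0 SD] [Sx x0 xirr]; split=> [|a b [Sa ax] [Sb bx]].
  by split=> //= x0'; rewrite -x0' in x0.
split=> /=; first exact: SD.
move=> abx; case: (posnP a) => [a0|a0]; first by apply: bx => /=; lia.
case: (posnP b) => [b0|b0]; first by apply: ax => /=; lia.
by apply: (xirr a b).
Qed.

Lemma generated_atoms (S : set nat) : submonoid S -> generated (atoms S) = S.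
Proof.
move=> hS; apply/seteqP; split=> x; first by apply; split=> // y [].
elim/ltn_ind: x => x IH Sx M hM; have [[M0 MD] GM] := hM.
case: (posnP x) => [->//|x0].
case: (pselect (atoms S x)) => [|Gx]; first exact: GM.
have [[a b]] : exists ab : nat * nat,
    [/\ S ab.1, S ab.2, (0 < ab.1)%N, (0 < ab.2)%N & x = (ab.1 + ab.2)%N].
  apply: contrapT => nab; apply: Gx; split=> // a b Sa Sb a0 b0 xab.
  by apply: nab; exists (a, b).
move=> /= [Sa Sb a0 b0 xab].
by rewrite xab; apply: MD; apply: IH => //; lia.
Qed.

(** A generating set missing the atom [x] would lie in [S \ x], which is still a submonoid, so it
    could not generate [x]. *)
Lemma atoms_sub_generators {S X : set nat} :
  submonoid S -> generated X = S -> atoms S `<=` X.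
Proof.
move=> hS XS x Gx; apply: contrapT => Xx.
have XSx : X `<=` S `\ x.
  move=> y Xy; split=> [|/= yx]; last by apply: Xx; rewrite -yx.
  by rewrite -XS => M [_]; apply.
have [Sx _ _] := Gx; rewrite -XS in Sx.
have [_] : (S `\ x) x by apply: Sx; split; first exact: submonoid_setD1.
exact.
Qed.

(** The atoms generate [S] and lie in every generating set, so they form its only minimal one; the
    [xget] behind [msg] never falls back to its default. *)
Lemma msgE (S : set nat) : submonoid S -> msg S = atoms S.
Proof.
move=> hS.
have [gen_msg msg_min] : minimal_system_of_generators S (msg S).
  apply: xgetPex; exists (atoms S); split; first exact: generated_atoms.
  by move=> Y [YG nGY] YS; apply: nGY; apply: atoms_sub_generators.
have Gmsg := atoms_sub_generators hS gen_msg.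
apply/seteqP; split=> //; apply: contrapT => nmsg.
by apply: (msg_min (atoms S)) => //; apply: generated_atoms.
Qed.

(** * Irreducibility as duality *)

(** For a numerical semigroup with Frobenius number [F] this is symmetry when [F] is odd and
    pseudo-symmetry when [F] is even. *)
Definition self_dual (F : nat) (S : set nat) : Prop :=
  forall x, (x <= F)%N -> ~ S x -> (2 * x)%N <> F -> S (F - x)%N.

Lemma numerical_semigroup_frobenius {S : set nat} {F : nat} :
  submonoid S -> has_frobenius S F -> numerical_semigroup S.
Proof.
move=> hS [_ SF]; split=> //; apply: (@sub_finite_set _ _ `I_F.+1) => [k nSk|].
  by rewrite /= ltnS; apply: SF.
exact: finite_II.
Qed.

Lemma frobenius_gt {S : set nat} {F k : nat} :
  has_frobenius S F -> (F < k)%N -> S k.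
Proof. by move=> [_ SF] Fk; apply: contrapT => /SF; lia. Qed.

Lemma numerical_semigroup_setU1 {S : set nat} {F x : nat} :
  submonoid S -> has_frobenius S F -> (F < 2 * x)%N ->
  (forall s, S s -> (0 < s)%N -> S (x + s)%N) ->
  numerical_semigroup (S `|` [set x]).
Proof.
move=> hS hF Fx xS; have [S0 SD] := hS.
have [_ finS] := numerical_semigroup_frobenius hS hF.
split; last first.
  by apply: sub_finite_set finS; apply: subsetC => y Sy; left.
have xS' s : S s -> (S `|` [set x]) (x + s)%N.
  case: (posnP s) => [-> _|s0 Ss]; [by right; rewrite /= addn0|by left; apply: xS].
split=> [|a b [Sa|->] [Sb|->]]; first by left.
- by left; apply: SD.
- by rewrite addnC; apply: xS'.
- exact: xS'.
- by left; apply: (frobenius_gt hF); lia.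
Qed.

(** Duality forces [F] into every semigroup properly containing [S], hence into any intersection of
    two of them. If duality fails at a suitable [x], then [S] is the intersection of [S U {x}] and
    [S U {F}]. *)
Lemma irreducibleP {S : set nat} {F : nat} :
  submonoid S -> has_frobenius S F -> (irreducible S <-> self_dual F S).
Proof.
move=> hS hF; have [S0 SD] := hS; have [nSF SF] := hF; split; last first.
  move=> dualS; split; first exact: numerical_semigroup_frobenius hF.
  have proper_F S' : numerical_semigroup S' -> S `<` S' -> S' F.
    move=> [[_ SD'] _] [SS' nS'S]; apply: contrapT => nS'F; apply: nS'S => x S'x.
    apply: contrapT => nSx.
    have xF : (x <= F)%N by apply: SF.
    case: (eqVneq (2 * x)%N F) => [xF2|/eqP xF2].
      by apply: nS'F; rewrite -xF2 mul2n -addnn; apply: SD'.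
    by apply: nS'F; rewrite -(subnKC xF); apply: SD' => //; apply: SS'; apply: dualS.
  move=> [S1 [S2 [nS1 nS2 SS1 SS2 SI]]]; apply: nSF.
  by rewrite SI; split; apply: proper_F.
move=> [_ irrS]; apply: contrapT => ndual.
(* the largest element violating duality can be adjoined to [S] *)
pose bad x := [/\ (x <= F)%N, ~ S x, (2 * x)%N <> F & ~ S (F - x)%N].
have [x0 bx0] : exists x, bad x.
  apply: contrapT => nb; apply: ndual => x xF nSx xF2.
  by apply: contrapT => nSFx; apply: nb; exists x.
have exb : exists x, `[< bad x >] by exists x0; apply/asboolP.
have boundb x : `[< bad x >] -> (x <= F)%N by move=> /asboolP[].
case: (ex_maxnP exb boundb) => x /asboolP[xF nSx xF2 nSFx] xmax.
(* Violation of duality is symmetric under [x |-> F - x], so maximality gives [F - x <= x]. *)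
have Fx : (F < 2 * x)%N.
  suff : (F - x <= x)%N by lia.
  apply: xmax; apply/asboolP; split=> //; [lia|lia|].
  by rewrite (_ : F - (F - x) = x)%N //; lia.
have FxF : (F < 2 * F)%N by lia.
have F_add s : S s -> (0 < s)%N -> S (F + s)%N.
  by move=> _ s0; apply: (frobenius_gt hF); lia.
have x_add s : S s -> (0 < s)%N -> S (x + s)%N.
  move=> Ss s0; apply: contrapT => nSxs.
  have xsF : (x + s <= F)%N by apply: SF.
  suff : (x + s <= x)%N by lia.
  apply: xmax; apply/asboolP; split=> //; first lia.
  move=> SFxs; apply: nSFx; rewrite (_ : F - x = F - (x + s) + s)%N; last lia.
  exact: SD.
apply: irrS; exists (S `|` [set x]), (S `|` [set F]); split.
- exact: numerical_semigroup_setU1 Fx x_add.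
- exact: numerical_semigroup_setU1 FxF F_add.
- by split; [move=> y; left|move=> /(_ x) Sx; apply: nSx; apply: Sx; right].
- by split; [move=> y; left|move=> /(_ F) SF'; apply: nSF; apply: SF'; right].
- apply/seteqP; split=> [y Sy|y [[Sy|/= yx]]]; [by split; left|by []|].
  (* The adjoined elements differ: [F - F = 0] lies in [S], while [F - x] does not. *)
  by case=> // /= yF; exfalso; apply: nSFx; rewrite -yx yF subnn.
Qed.

Definition dual_semigroup (m F : nat) (S : set nat) : Prop :=
  [/\ submonoid S, is_smallest [set x | S x /\ (0 < x)%N] m,
      has_frobenius S F & self_dual F S].

Lemma irreduciblesP (m F : nat) (S : set nat) :
  irreducibles m F S <-> dual_semigroup m F S.
Proof.
split=> [[irrS mS hF]|[hS hm hF dS]].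
  have hS : submonoid S by case: irrS => -[].
  split=> //; last by apply/irreducibleP.
  (* [F.+1] is a positive element of [S], so the multiplicity is a true minimum and not the default
     0. *)
  rewrite -mS; apply: (is_smallest_minimum F.+1); split=> //.
  exact: (frobenius_gt hF).
by split=> //; [apply/(irreducibleP hS hF)|apply: minimum_eq].
Qed.

(** * Exchanging an atom [x] for [F - x] *)

Lemma submonoid_dvd {S : set nat} {m k : nat} :
  submonoid S -> S m -> (m %| k)%N -> S k.
Proof.
move=> [S0 SD] Sm /dvdnP[q ->]; elim: q => // q IH.
by rewrite mulSn; apply: SD.
Qed.

Lemma atoms_leq {S : set nat} {x s : nat} :
  atoms S x -> S s -> (0 < s)%N -> s <> x -> (s <= x)%N -> ~ S (x - s)%N.
Proof.
by move=> [_ _ xirr] Ss s0 sx slex Sxs; apply: (xirr s (x - s)%N) => //; lia.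
Qed.

Definition swap (F x : nat) (S : set nat) : set nat :=
  (S `\ x) `|` [set (F - x)%N].

Lemma swapK (F x : nat) (S : set nat) :
  (x <= F)%N -> S x -> ~ S (F - x)%N -> swap F (F - x) (swap F x S) = S.
Proof.
move=> xF Sx nSFx; rewrite /swap subKn //; apply/seteqP; split=> y.
  by case=> [[[[]//|/= ->] //]|/= ->].
move=> Sy; case: (eqVneq y x) => [->|/eqP yx]; first by right.
by left; split; [left|move=> /= yFx; apply: nSFx; rewrite -yFx].
Qed.

Lemma swap_frobenius (F x : nat) (S : set nat) :
  (0 < x < F)%N -> has_frobenius S F -> has_frobenius (swap F x S) F.
Proof.
move=> xF hF; split=> [[[SF _]|/= FFx]|k nSk]; [by case: hF|lia|].
rewrite leqNgt; apply/negP => Fk; apply: nSk; left; split=> [|/= kx]; last lia.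
exact: (frobenius_gt hF).
Qed.

Lemma swap_self_dual (F x : nat) (S : set nat) :
  (x <= F)%N -> self_dual F S -> self_dual F (swap F x S).
Proof.
move=> xF dS y yF nSy y2; case: (eqVneq y x) => [->|/eqP yx]; first by right.
have nSy' : ~ S y by move=> Sy; apply: nSy; left.
have yFx : y <> (F - x)%N by move=> yFx; apply: nSy; right.
by left; split; [apply: dS|move=> /=; lia].
Qed.

(** Removing an atom keeps closure under addition, so only sums involving the new element [F - x]
    remain to be checked. *)
Lemma swap_submonoid (F x : nat) (S : set nat) :
  submonoid S -> atoms S x ->
  (forall s, S s -> (0 < s)%N -> s <> x -> swap F x S (F - x + s)%N) ->
  swap F x S (F - x + (F - x))%N -> submonoid (swap F x S).
Proof.
move=> hS xS hs h2; have [S0' SD'] := submonoid_setD1 hS xS.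
have hs' s : (S `\ x) s -> swap F x S (F - x + s)%N.
  move=> [Ss /= sx]; case: (posnP s) => [->|s0]; last exact: hs.
  by right; rewrite /= addn0.
split=> [|a b [Sa|->] [Sb|->]] //; first by left.
- by left; apply: SD'.
- by rewrite addnC; apply: hs'.
- exact: hs'.
Qed.

Lemma swap_dual_semigroup (m F x : nat) (S : set nat) :
  dual_semigroup m F S -> (x < F)%N -> (m < x)%N -> (m < F - x)%N ->
  submonoid (swap F x S) -> dual_semigroup m F (swap F x S).
Proof.
move=> [_ [[Sm m0] mmin] hF dS] xF mx mFx hS'; split=> //.
- split=> [|k [[[Sk _]|/= ->] k0]]; last 1 first.
  + exact: ltnW.
  + by split=> //; left; split=> //= mx'; lia.
  + by apply: mmin.
- by apply: swap_frobenius => //; lia.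
- by apply: swap_self_dual => //; lia.
Qed.

(** * Gaps, multiplicity and ratio *)

Lemma dual_semigroup_setC {m F : nat} {S : set nat} {x : nat} :
  dual_semigroup m F S -> (x <= F)%N -> S x -> ~ S (F - x)%N.
Proof.
by move=> [[_ SD] _ [nSF _] _] xF Sx SFx; apply: nSF; rewrite -(subnKC xF); apply: SD.
Qed.

Lemma dual_semigroup_half {m F : nat} {S : set nat} {x : nat} :
  dual_semigroup m F S -> S x -> (2 * x)%N <> F.
Proof.
move=> [[_ SD] _ [nSF _] _] Sx xF; apply: nSF.
by rewrite -xF mul2n -addnn; apply: SD.
Qed.

Lemma multiplicity_dual_semigroup {m F : nat} {S : set nat} :
  dual_semigroup m F S -> multiplicity S = m.
Proof. by move=> [_ hm _ _]; apply: minimum_eq. Qed.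

Lemma ratio_dual_semigroup {m F : nat} {S : set nat} :
  (0 < m)%N -> ~~ (m %| F)%N -> dual_semigroup m F S ->
  is_smallest [set x | S x /\ ~~ (m %| x)%N] (ratio S).
Proof.
move=> m0 mF dS; rewrite /ratio (multiplicity_dual_semigroup dS).
(* [F + m] exceeds [F], hence lies in [S], and [m] does not divide it. *)
apply: (is_smallest_minimum (F + m)%N); split; last by rewrite dvdn_addl.
by case: dS => _ _ hF _; apply: (frobenius_gt hF); lia.
Qed.

(** Positive summands of [r] lying in [S] are smaller than [r], hence multiples of [m]; then [r]
    would be one too. *)
Lemma ratio_atom {m : nat} {S : set nat} {r : nat} :
  submonoid S -> is_smallest [set x | S x /\ ~~ (m %| x)%N] r -> atoms S r.
Proof.
move=> hS [[Sr mr] rmin]; split=> // [|a b Sa Sb a0 b0 rab].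
  by case: (posnP r) mr => // ->; rewrite dvdn0.
have dvd_lt c : S c -> (c < r)%N -> (m %| c)%N.
  by move=> Sc cr; apply: contraT => mc; have := rmin c (conj Sc mc); lia.
by move/negP: mr; apply; rewrite rab dvdn_add // dvd_lt //; lia.
Qed.

(** * The forward step and its inverse *)

(** If [F - x + s] were a gap, duality would put [x - s] in [S], against [x] being an atom. The
    conditions in [alpha] settle the exceptional cases and the sum [2 (F - x)]. The new element
    [F - x] is no multiple of [m] and lies below [ratio S], so the ratio drops. *)
Lemma E_dual_semigroup {m F : nat} {S T : set nat} :
  (0 < m)%N -> ~~ (m %| F)%N -> dual_semigroup m F S -> E F S T ->
  dual_semigroup m F T /\ (ratio T < ratio S)%N.
Proof.
move=> m0 mF dS [x [xmsg [Fx xF] nSd [x32 x43] [mx xr]] <-].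
rewrite -/(swap F x S).
rewrite (multiplicity_dual_semigroup dS) in mx.
have [hS [[Sm _] mmin] hF dual] := dS; have [S0 SD] := hS.
rewrite msgE // in xmsg; have [Sx x0 _] := xmsg.
have nSFx := dual_semigroup_setC dS (ltnW xF) Sx.
have dT : dual_semigroup m F (swap F x S).
  apply: swap_dual_semigroup => //; first lia.
  apply: swap_submonoid => // [s Ss s0 sx|]; left; split.
  - apply: contrapT => nS.
    have FxsF : (F - x + s <= F)%N by case: hF => _; apply.
    have : S (F - (F - x + s))%N.
      (* The self-dual exception [2 (F - x + s) = F] means [2x - F = 2s], an element of [S]. *)
      apply: dual => // Fxs2; apply: nSd.
      by rewrite (_ : 2 * x - F = s + s)%N; [apply: SD|lia].
    rewrite (_ : F - (F - x + s) = x - s)%N; last lia.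
    by apply: (atoms_leq xmsg) => //; lia.
  - by move=> /= e; apply: nSd; rewrite (_ : 2 * x - F = s)%N //; lia.
  - apply: contrapT => nS; apply: nSd.
    (* [4x <> 3F] keeps [2 (F - x)] away from [F / 2], so duality applies; [3x <> 2F] then gives
       [2 (F - x) <> x]. *)
    rewrite (_ : 2 * x - F = F - (F - x + (F - x)))%N; last lia.
    by apply: dual => //; lia.
  - by move=> /=; lia.
split=> //; have [_ rmin] := ratio_dual_semigroup m0 mF dT.
apply: leq_ltn_trans xr; apply: rmin; split; first by right.
by apply/negP => /(submonoid_dvd hS Sm).
Qed.

Lemma E_parent {m F : nat} {T : set nat} :
  (0 < m)%N -> ~~ (m %| F)%N -> dual_semigroup m F T -> (2 * ratio T <= F)%N ->
  exists S, [/\ dual_semigroup m F S, (ratio T < ratio S)%N & E F S T].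
Proof.
move=> m0 mF dT rF; have rT := ratio_dual_semigroup m0 mF dT.
set r := ratio T in rF rT *.
have [[Tr mr] rmin] := rT.
have [hT [[Tm _] mmin] hF dual] := dT; have [T0 TD] := hT.
have rat := ratio_atom hT rT; have [_ r0 _] := rat.
have r2F := dual_semigroup_half dT Tr.
have nTFr : ~ T (F - r)%N by apply: (dual_semigroup_setC dT) => //; lia.
have ltmr : (m < r)%N.
  by rewrite ltn_neqAle mmin // andbT; apply: contra mr => /eqP <-.
have dS : dual_semigroup m F (swap F r T).
  apply: swap_dual_semigroup => //; [lia|lia|].
  apply: swap_submonoid => // [s Ts s0 sr|]; left; split; rewrite /=; try lia.
  - apply: contrapT => nT.
    have FrsF : (F - r + s <= F)%N by case: hF => _; apply.
    have : T (F - (F - r + s))%N by apply: dual => //; lia.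
    rewrite (_ : F - (F - r + s) = r - s)%N; last lia.
    by apply: (atoms_leq rat) => //; lia.
  - by apply: (frobenius_gt hF); lia.
(* Old elements that are not multiples of [m] exceed [r] once [r] is removed, and [F - r > r]. *)
have rS : (r < ratio (swap F r T))%N.
  have [[[[TrS /= rSr]|/= ->] mrS] _] := ratio_dual_semigroup m0 mF dS; last lia.
  by have := rmin _ (conj TrS mrS); lia.
have swap_T y : swap F r T y -> (y < F - r)%N -> T y.
  by case=> [[]//|/= ->]; rewrite ltnn.
exists (swap F r T); split=> //; exists (F - r)%N; last first.
  by rewrite -/(swap _ _ _) swapK //; lia.
have rFr : (F - (F - r) = r)%N by lia.
split; rewrite ?rFr ?(multiplicity_dual_semigroup dS) //; last 1 first.
(* The two excluded equations for [x = F - r] amount to [F = 3r] and [F = 4r], which would put [F]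
   in [T]. *)
- have T2 := TD _ _ Tr Tr; have T3 := TD _ _ T2 Tr; have T4 := TD _ _ T3 Tr.
  have nTF : ~ T F by case: hF.
  split=> e; apply: nTF.
  + by rewrite (_ : F = r + r + r)%N //; lia.
  + by rewrite (_ : F = r + r + r + r)%N //; lia.
- rewrite msgE; last by case: dS.
  (* The summands of [F - r] are smaller than it, hence already in [T], which does not contain
     [F - r]. *)
  split; [by right|lia|move=> a b Sa Sb a0 b0 Fab].
  by apply: nTFr; rewrite Fab; apply: TD; apply: swap_T => //; lia.
- lia.
- move=> Sd; have /swap_T Td := Sd.
  have : T (2 * (F - r) - F)%N by apply: Td; lia.
  rewrite (_ : 2 * (F - r) - F = F - (r + r))%N; last lia.
  by apply: (dual_semigroup_setC dT); [lia|apply: TD].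
Qed.

(** * Explicit form of [C(m, F)] *)

(** Only multiples of [m] occur up to [F / 2]; duality dictates the rest. The guard [x <= F]
    matters: beyond [F] the truncated [F - x] is 0, which [m] divides. *)
Definition large_ratio (m F : nat) : set nat :=
  [set x | if (F < 2 * x)%N then (x <= F)%N ==> ~~ (m %| F - x)%N
           else (m %| x)%N].

Lemma dual_semigroup_large_ratio {m F : nat} {S : set nat} :
  (0 < m)%N -> ~~ (m %| F)%N -> dual_semigroup m F S -> (F < 2 * ratio S)%N ->
  S = large_ratio m F.
Proof.
move=> m0 mF dS Fr; have [[Sr mr] rmin] := ratio_dual_semigroup m0 mF dS.
have [hS [[Sm _] mmin] hF dual] := dS.
have small x : (2 * x <= F)%N -> S x -> (m %| x)%N.
  by move=> xF Sx; apply: contraT => mx; have := rmin _ (conj Sx mx); lia.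
have dvdS x : (m %| x)%N -> S x by apply: submonoid_dvd.
apply/seteqP; split=> x; rewrite /large_ratio /=.
  move=> Sx; case: ltnP => [Fx|xF]; last exact: small.
  apply/implyP => xF; apply/negP => /dvdS.
  exact: (dual_semigroup_setC dS).
case: ltnP => [Fx|xF]; last exact: dvdS.
case: (leqP x F) => [xF /= nm|Fltx _]; last exact: (frobenius_gt hF).
apply: contrapT => nSx; move/negP: nm; apply; apply: small; first lia.
by apply: dual => //; lia.
Qed.

Lemma large_ratio_dual_semigroup {m F : nat} :
  (0 < m)%N -> (2 * m <= F + 2)%N -> ~~ (m %| F)%N ->
  dual_semigroup m F (large_ratio m F).
Proof.
move=> m0 hmF mF.
have dvd_in x : (m %| x)%N -> large_ratio m F x.
  rewrite /large_ratio /= => mx; case: ltnP => // _; apply/implyP => xF.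
  by rewrite dvdn_subl.
have add_large a b : large_ratio m F a -> large_ratio m F b -> (F < 2 * b)%N ->
    large_ratio m F (a + b)%N.
  rewrite /large_ratio /= => ha hb Fb; move: hb; rewrite Fb.
  rewrite (_ : F < 2 * (a + b))%N; last lia.
  (* If [a] is also above [F / 2], the sum exceeds [F]. Otherwise [m] divides [a], and if it divided
     [F - (a + b)] it would divide [F - b]. *)
  case: ltnP ha => [Fa _ _|aF ma /implyP hb]; first by apply/implyP; lia.
  apply/implyP => abF; apply/negP => mFab.
  have /negP := hb ltac:(lia); apply.
  by rewrite (_ : F - b = F - (a + b) + a)%N; [rewrite dvdn_add|lia].
split.
- split=> [|a b ha hb]; first by apply: dvd_in; apply: dvdn0.
  case: (ltnP F (2 * b)) => [Fb|bF]; first exact: add_large.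
  case: (ltnP F (2 * a)) => [Fa|aF].
    by rewrite addnC; apply: add_large.
  apply: dvd_in; move: ha hb; rewrite /large_ratio /= !ltnNge aF bF /=; exact: dvdn_add.
- split=> [|k []]; first by split=> //; apply: dvd_in.
  (* For [k] above [F / 2], [2k >= F + 1 >= 2m - 1] forces [k >= m]. *)
  by rewrite /large_ratio /=; case: ltnP => [Fk _ _|_ mk k0]; [lia|apply: dvdn_leq].
- split=> [|k]; rewrite /large_ratio /=.
    by case: ltnP => [_|_]; [rewrite leqnn subnn dvdn0|apply/negP].
  case: ltnP => [_|]; last lia.
  by case: leqP.
- rewrite /large_ratio => x xF /= nx x2; case: ltnP nx => [Fx|xF2].
    rewrite xF /= => /negP; rewrite negbK => mFx.
    by rewrite (_ : F < 2 * (F - x) = false)%N //; lia.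
  move=> /negP mx; rewrite (_ : F < 2 * (F - x))%N; last lia.
  by rewrite leq_subr /= subKn.
Qed.

Lemma ratio_large_ratio {m F : nat} :
  (0 < m)%N -> (2 * m <= F + 2)%N -> ~~ (m %| F)%N ->
  (F < 2 * ratio (large_ratio m F))%N.
Proof.
move=> m0 hmF mF.
have [[+ mr] _] := ratio_dual_semigroup m0 mF (large_ratio_dual_semigroup m0 hmF mF).
by rewrite {1}/large_ratio /=; case: ltnP => // _ /(negP mr).
Qed.

Lemma CsgE {m F : nat} :
  (0 < m)%N -> (2 * m <= F + 2)%N -> ~~ (m %| F)%N -> Csg m F = large_ratio m F.
Proof.
move=> m0 hmF mF.
have [/irreduciblesP dC FC] : [set S | irreducibles m F S /\ (F < 2 * ratio S)%N] (Csg m F).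
  apply: xgetPex; exists (large_ratio m F); split; last exact: ratio_large_ratio.
  by apply/irreduciblesP; apply: large_ratio_dual_semigroup.
exact: dual_semigroup_large_ratio.
Qed.

(** * Correctness and termination of the procedure *)

(** Each level costs at least one unit of ratio; the bound on [i] this gives yields termination. *)
Lemma A_sound {m F i : nat} {S : set nat} :
  (0 < m)%N -> (2 * m <= F + 2)%N -> ~~ (m %| F)%N -> A m F i S ->
  dual_semigroup m F S /\ (ratio S + i <= ratio (Csg m F))%N.
Proof.
move=> m0 hmF mF; elim: i S => [S ->|i IH T [S /IH[dS rS] /(E_dual_semigroup m0 mF dS)[dT rT]]].
  by split; [rewrite CsgE //; apply: large_ratio_dual_semigroup|rewrite addn0].
by split=> //; lia.
Qed.

Lemma A_complete {m F : nat} {T : set nat} :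
  (0 < m)%N -> (2 * m <= F + 2)%N -> ~~ (m %| F)%N -> dual_semigroup m F T ->
  exists i, A m F i T.
Proof.
move=> m0 hmF mF.
(* Passing to the parent raises the ratio. It is done only when [2 * ratio T <= F], so the truncated
   [F - ratio T] is positive and really decreases. *)
elim/ltn_ind: {T}(F - ratio T)%N {-2}T (erefl (F - ratio T)%N) => n IH T nT dT.
case: (ltnP F (2 * ratio T)) => [FT|TF].
  by exists 0%N; rewrite /= CsgE //; apply: dual_semigroup_large_ratio.
have [S [dS rS ET]] := E_parent m0 mF dT TF.
have [[Tr mr] _] := ratio_dual_semigroup m0 mF dT.
have [i Ai] := IH (F - ratio S)%N ltac:(lia) S erefl dS.
by exists i.+1, S.
Qed.

Theorem mainTheorem12 (m F : nat) (hm : (0 < m)%N) (hF : (3 <= F)%N)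
    (hmF : (2 * m <= F + 2)%N) (hdvd : ~~ (m %| F)%N) :
  exists out : set (set nat),
      [/\ procedure_returns m F out,
          out = \bigcup_i A m F i
        & out = irreducibles m F].
Proof.
exists (\bigcup_i A m F i); split=> //; last first.
  apply/seteqP; split=> S; first by move=> [i _ /(A_sound hm hmF hdvd)[dS _]]; apply/irreduciblesP.
  by move=> /irreduciblesP /(A_complete hm hmF hdvd)[i Ai]; exists i.
have exA : exists n, `[< A m F n = set0 >].
  (* A member of this level would violate the ratio bound of [A_sound]. *)
  exists (ratio (Csg m F)).+1; apply/asboolP/seteqP; split=> // S.
  by move=> /(A_sound hm hmF hdvd)[_]; lia.
case: (ex_minnP exA) => n /asboolP An nmin.
exists n; split=> // [i ltin Ai|].
  by have := nmin i (asboolT Ai); lia.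
(* Once a level is empty all later ones are, so stopping at [n] loses nothing from the full
   union. *)
have A0 k : A m F (n + k) = set0.
  by elim: k => [|k IH]; rewrite ?addn0 // addnS /= IH bigcup_set0.
apply/seteqP; split=> S [i _ Ai]; last by exists i.
case: (leqP i n) => [lein|ltni]; first by exists i.
by move: Ai; rewrite -(subnKC (ltnW ltni)) A0.
Qed.
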